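(* Fix $p\in\{1,\dots,k\}$ and $q\in\{1,\dots,d_p\}$, and let $\Gamma_j=\mathrm{ins}_p\big((e_j^p)^{\otimes d_p}\otimes\tilde\Gamma_j\big)$, $j\ne p$, decompose in grouped $p$-slots. If $\ell_p<m$ and if $$\langle\mu,\beta\rangle^2,\quad\langle\mu,\beta\rangle\,\partial_{x_{pq}}\langle\mu,\beta\rangle,\quad(\partial_{x_{pq}}\langle\mu,\beta\rangle)^2$$ are linearly independent over the rational functions $\mathbb R(x_{pq})$, then for every solution of the extremality equation (E), the function $$A_{pq}(x_{pq})=\frac{N_{pq}(x_{pq})}{\prod_{j\ne p}\langle(1,x_{pq}),e_j^p\rangle^{d_j}}$$ ($N_{pq}$ a polynomial) must be such that $\deg N_{pq}\le\ell_p$.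
   Context: Segre–Veronese factorization structure. Let $m=d_1+\cdots+d_k$, $m\ge2$, $d_j\ge1$, $W_1,\dots,W_k$ 2-dimensional real vector spaces, $V^*=\bigotimes_{i=1}^k(W_i^* )^{\otimes d_i}$ with slots labelled $(i,r)$; the slots $(p,1),\dots,(p,d_p)$ are the grouped $p$-slots. $\mathrm{ins}_j$ denotes the linear map reordering tensor factors so that the first $d_j$ factors are put in the grouped $j$-slots (used also when some other group of slots is absent). Let $\Gamma_j\in\bigotimes_{r\ne j}(W_r^* )^{\otimes d_r}$ be non-zero tensors such that $\mathfrak h:=\sum_{j}\mathrm{ins}_j(S^{d_j}W_j^*\otimes\langle\Gamma_j\rangle)\subset V^*$ has dimension $m+1$; $\varphi:\mathfrak h\hookrightarrow V^*$ is the inclusion. For $k=1$ (Veronese) $\mathfrak h=S^mW^*$, $\Gamma_1=1$. Notation. Identify $W_i,W_i^*$ with $\mathbb R^2$, $\langle(u,v),(a,b)\rangle=ua+vb$. With real variables $x_{ir}$: $\mathbf x=\bigotimes_{i,r}(1,x_{ir})$, $\hat{\mathbf x}_i=\bigotimes_{j\ne i}\bigotimes_s(1,x_{js})$, $\langle\mu,\alpha\rangle=\langle\mathbf x,\varphi(\alpha)\rangle$ for $\alpha\in\mathfrak h$, $\Delta_{ir}=\prod_{s\ne r}(x_{ir}-x_{is})$ ($=1$ if $d_i=1$). Fix $0\ne\beta\in\mathfrak h$. A solution of the extremality equation is a family of smooth non-vanishing functions $A_{ir}$ of one variable on open intervals $I_{ir}$ (with $\Delta_{ir},\langle\hat{\mathbf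 x}_i,\Gamma_i\rangle,\langle\mu,\beta\rangle$ non-vanishing on $\prod I_{ir}$) such that for some $\alpha\in\mathfrak h$ $$\text{(E)}\quad\sum_{i=1}^k\sum_{r=1}^{d_i}\frac{\langle\mu,\beta\rangle^{m+3}}{\Delta_{ir}\langle\hat{\mathbf x}_i,\Gamma_i\rangle\prod_{b=1}^k\langle\hat{\mathbf x}_b,\Gamma_b\rangle^{d_b}}\partial_{x_{ir}}^2\Big(\frac{A_{ir}(x_{ir})}{\langle\mu,\beta\rangle^{m+1}}\prod_{j=1}^k\langle\hat{\mathbf x}_j,\Gamma_j\rangle^{d_j}\Big)=\langle\mu,\alpha\rangle .$$ $\ell_p$: multiply (E) by $\Delta_{pq}\prod_b\langle\hat{\mathbf x}_b,\Gamma_b\rangle^{d_b}$ (for $k=1$ by $\Delta_{pq}$); then $\ell_p$ is the maximum of the $x_{pq}$-degrees of the coefficients at $A_{ir},A_{ir}',A_{ir}''$, $(i,r)\ne(p,q)$, and of the right-hand side (for general $\alpha\in\mathfrak h$); these are polynomials in $x_{pq}$ and $\ell_p$ does not depend on $q$. Linear independence over $\mathbb R(x_{pq})$ is understood in the field of rational functions in all variables $x_{ir}$. *)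

(* Defs.v *)
From HB Require Import structures.
From mathcomp Require Import all_boot all_order perm all_algebra.
From mathcomp Require Import all_classical all_reals all_analysis.
(* The notations of mpoly clash with those of analysis. *)
From mathcomp Require Import (canonicals) mpoly.
Set Implicit Arguments.
Unset Strict Implicit.
Unset Printing Implicit Defensive.
Import Order.TTheory GRing.Theory Num.Theory.
Import numFieldNormedType.Exports.
Local Open Scope classical_set_scope.
Local Open Scope ring_scope.

(** ** Slots and tensors *)

(* The slot (i, r) is [Tagged (fun i => 'I_(d i)) r]; indices start at 0. *)
Notation slot d := {i & 'I_(d i)}.

Definition mkslot (k : nat) (d : 'I_k -> nat) (i : 'I_k) (r : 'I_(d i)) :
  slot d := Tagged (fun i => 'I_(d i)) r.

Notation groups k := [set: 'I_k]%SET.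

Notation slots d G := {s : slot d | tag s \in G%SET}.

(* Tensors on the slots S with values in the tensor power of (R^2)^*, given
   by their coefficients in the canonical basis: a multi-index assigns to each
   slot one of the two coordinates. *)
Notation tensor R S := {ffun {ffun S -> 'I_2} -> R^o}.

Section Tensors.
Variables (R : realType) (k : nat) (d : 'I_k -> nat).
Implicit Types (G : {set 'I_k}) (j : 'I_k).

(* The coordinate that a assigns to s; the default value 0 is never used when
   s is one of the slots of G. *)
Definition coord G (a : {ffun slots d G -> 'I_2}) (s : slot d) : 'I_2 :=
  if insub s is Some u then a u else ord0.

(* ins_j (T (x) U), on the slots of the groups in G (with j \in G). *)
Definition ins G j (U : tensor R (slots d (G :\ j))) (T : tensor R 'I_(d j)) :
    tensor R (slots d G) :=
  [ffun a => T [ffun r => coord a (mkslot r)]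
             * U [ffun s => coord a (val s)]].

Definition tpow (n : nat) (e : 'rV[R]_2) : tensor R 'I_n :=
  [ffun a : {ffun 'I_n -> 'I_2} => \prod_r e 0 (a r)].

Definition tperm_act (n : nat) (g : 'S_n) (T : tensor R 'I_n) :
    tensor R 'I_n :=
  [ffun a : {ffun 'I_n -> 'I_2} => T [ffun r => a (g r)]].

Definition Sym (n : nat) : {vspace tensor R 'I_n} :=
  (\bigcap_(g : 'S_n) fixedSpace (linfun (@tperm_act n g)))%VS.

Definition frakh (Gamma : forall j, tensor R (slots d (groups k :\ j))) :
    {vspace tensor R (slots d (groups k))} :=
  (\sum_j linfun (ins (Gamma j)) @: Sym (d j))%VS.

(* Gamma is part of a Segre-Veronese factorization structure. *)
Definition segre_veronese
    (Gamma : forall j, tensor R (slots d (groups k :\ j))) : Prop :=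
  [/\ (2 <= \sum_j d j)%N,
      forall j, (1 <= d j)%N,
      forall j, Gamma j != 0,
      k = 1%N -> forall j, Gamma j = [ffun=> 1]
    & \dim (frakh Gamma) = (\sum_j d j).+1%N].

End Tensors.

(* [linfun f] is f only when f is linear, which holds where it is used. *)
Lemma tperm_act_is_linear (R : realType) (n : nat) (g : 'S_n) :
  linear (@tperm_act R n g).
Proof. by move=> c T1 T2; apply/ffunP => a; rewrite !ffunE. Qed.

Lemma ins_is_linear (R : realType) (k : nat) (d : 'I_k -> nat)
    (G : {set 'I_k}) (j : 'I_k) (U : tensor R (slots d (G :\ j))) :
  linear (ins U).
Proof.
by move=> c T1 T2; apply/ffunP => a; rewrite !ffunE mulrDl -scalerAl.
Qed.

HB.instance Definition _ (R : realType) (n : nat) (g : 'S_n) :=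
  GRing.isLinear.Build R (tensor R 'I_n) (tensor R 'I_n) _ (@tperm_act R n g)
    (@tperm_act_is_linear R n g).

HB.instance Definition _ (R : realType) (k : nat) (d : 'I_k -> nat)
    (G : {set 'I_k}) (j : 'I_k) (U : tensor R (slots d (G :\ j))) :=
  GRing.isLinear.Build R (tensor R 'I_(d j)) (tensor R (slots d G)) _ (ins U)
    (ins_is_linear U).

Lemma SymP (R : realType) (n : nat) (T : tensor R 'I_n) :
  T \in Sym R n <->
  forall (g : 'S_n) (a : {ffun 'I_n -> 'I_2}), T [ffun r => a (g r)] = T a.
Proof.
rewrite /Sym memvE; split=> [/subv_bigcapP H g a|H].
  have := H g isT; rewrite -memvE => /fixedSpaceP; rewrite lfunE /=.
  by move=> /ffunP/(_ a); rewrite ffunE.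
apply/subv_bigcapP => g _; rewrite -memvE; apply/fixedSpaceP.
by rewrite lfunE; apply/ffunP => a; rewrite ffunE H.
Qed.

Lemma frakhP (R : realType) (k : nat) (d : 'I_k -> nat)
    (Gamma : forall j, tensor R (slots d (groups k :\ j)))
    (alpha : tensor R (slots d (groups k))) :
  alpha \in frakh Gamma <->
  exists2 T : forall j, tensor R 'I_(d j),
    forall j, T j \in Sym R (d j) & alpha = \sum_j ins (Gamma j) (T j).
Proof.
split=> [/memv_sumP[v hv ->]|[T hT ->]].
  have H j : exists T, T \in Sym R (d j) /\ v j = ins (Gamma j) T.
    by have /memv_imgP[T hT ->] := hv j isT; exists T; rewrite lfunE.
  exists (fun j => projT1 (cid (H j))) => [j|].
    by case: (cid (H j)) => T [].
  by apply: eq_bigr => j _; case: (cid (H j)) => T [].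
apply: memv_sumr => j _; apply/memv_imgP.
by exists (T j); [exact: hT|rewrite lfunE].
Qed.

(** ** Evaluation at the decomposable tensors (1, x) (x) ... (x) (1, x) *)

Definition pt (F : comNzRingType) (x : F) : 'rV[F]_2 := \row_t x ^+ t.

Definition dot (F : comNzRingType) (v e : 'rV[F]_2) : F :=
  \sum_t v 0 t * e 0 t.

(* The pairing of T with the tensor product of the (1, x s) over the slots s
   of G; the coefficients of T are mapped to F by c, so that x may consist of
   real numbers or of indeterminates. *)
Definition pairing (R : realType) (F : comNzRingType) (c : R -> F) (k : nat)
    (d : 'I_k -> nat) (G : {set 'I_k}) (x : slot d -> F)
    (T : tensor R (slots d G)) : F :=
  \sum_(a : {ffun slots d G -> 'I_2})
    (\prod_(s : slots d G) pt (x (val s)) 0 (a s)) * c (T a).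

Section Equation.
Variables (R : realType) (k : nat) (d : 'I_k -> nat).
Variable Gamma : forall j, tensor R (slots d (groups k :\ j)).
Variable beta : tensor R (slots d (groups k)).
Implicit Types (x : slot d -> R) (s : slot d).
Implicit Types (alpha : tensor R (slots d (groups k))).

Local Notation m := (\sum_j d j)%N.

Definition mu x alpha : R := pairing id x alpha.

Definition hatG x (i : 'I_k) : R := pairing id x (Gamma i).

Definition prodG x : R := \prod_(b < k) hatG x b ^+ d b.

Definition Delta x s : R :=
  \prod_(r : 'I_(d (tag s)) | r != tagged s) (x s - x (mkslot r)).

Definition upd x s (y : R) : slot d -> R := @dfwith _ (fun=> R) x s y.

Definition partial (n : nat) s (f : (slot d -> R) -> R) x : R :=
  derive1n n (fun y => f (upd x s y)) (x s).

Definition regular x : Prop :=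
  [/\ forall s, Delta x s != 0, forall i, hatG x i != 0 & mu x beta != 0].

Definition prefactor s x : R :=
  mu x beta ^+ (m + 3)%N / (Delta x s * hatG x (tag s) * prodG x).

Definition lhsE (A : slot d -> R -> R) x : R :=
  \sum_(i < k) \sum_(r < d i)
    let s := mkslot r in
    prefactor s x *
    partial 2 s (fun z => A s (z s) / mu z beta ^+ (m + 1)%N * prodG z) x.

Definition extremal_solution (I : slot d -> set R) (A : slot d -> R -> R) :
    Prop :=
  [/\ forall s, [/\ open (I s), is_interval (I s) & I s !=set0],
      forall s y, I s y ->
        A s y != 0 /\ forall n, derivable (derive1n n (A s)) y 1,
      forall x, (forall s, I s (x s)) -> regular x
    & exists2 alpha, alpha \in frakh Gamma &
        forall x, (forall s, I s (x s)) -> lhsE A x = mu x alpha].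

(** ** The number ell_p *)

(* The coefficient at the t-th derivative of A_s in the equation
   lhsE A x = mu x alpha (see extremal_solution) multiplied by
   Delta_pq * prodG, where pq is a fixed slot: by the Leibniz rule,
   (A g)'' = \sum_t 'C(2, t) A^(t) g^(2 - t). For k = 1 one has prodG = 1. *)
Definition coefE (pq s : slot d) (t : 'I_3) x : R :=
  Delta x pq * prodG x * prefactor s x * 'C(2, t)%:R *
  partial (2 - t)%N s (fun z => prodG z / mu z beta ^+ (m + 1)%N) x.

Definition rhsE (pq : slot d) alpha x : R :=
  Delta x pq * prodG x * mu x alpha.

(* Where no denominator vanishes, f is a polynomial of degree at most n in x_pq, whose
   coefficients are functions of the other variables. *)
Definition xdeg_le (pq : slot d) (n : nat) (f : (slot d -> R) -> R) : Prop :=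
  exists2 a : 'I_n.+1 -> (slot d -> R) -> R,
    forall t x y, a t (upd x pq y) = a t x
    & forall x, regular x -> f x = \sum_t a t x * x pq ^+ t.

Definition ell_bound (pq : slot d) (n : nat) : Prop :=
  (forall s t, s != pq -> xdeg_le pq n (coefE pq s t)) /\
  (forall alpha, alpha \in frakh Gamma -> xdeg_le pq n (rhsE pq alpha)).

(* The maximum of the degrees, i.e. their least common upper bound; the degree
   of the right-hand side for general alpha is the largest one that occurs. *)
Definition ell (pq : slot d) : nat :=
  xget 0%N [set n | ell_bound pq n /\
                    forall n', ell_bound pq n' -> (n <= n')%N].

End Equation.

(** ** Rational functions in all the variables x_s *)

Notation polyring R d := (mpoly.mpoly #|{: slot d}| R).
Notation ratfield R d := {fraction (polyring R d)}.

Section RationalFunctions.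
Variables (R : realType) (k : nat) (d : 'I_k -> nat).

Definition Xvar (s : slot d) : polyring R d :=
  mpoly.mpolyX R (mpoly.mnm1 (enum_rank s)).

(* <mu, alpha> as a polynomial in the variables x_s *)
Definition muX (alpha : tensor R (slots d (groups k))) : polyring R d :=
  pairing (F := polyring R d) (@mpoly.mpolyC _ R) Xvar alpha.

Definition partialX (s : slot d) (P : polyring R d) : polyring R d :=
  mpoly.mderiv (enum_rank s) P.

Definition subst_var (s : slot d) (u : {poly R}) : polyring R d :=
  (map_poly (@mpoly.mpolyC _ R) u).[Xvar s].

(* The subfield R(x_s) of the field of rational functions. *)
Definition ratfun_in (s : slot d) : set (ratfield R d) :=
  [set c | exists u v : {poly R}, v != 0 /\
     c = FracField.tofrac (subst_var s u) / FracField.tofrac (subst_var s v)].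

Definition lin_indep_over (s : slot d) (n : nat) (f : 'I_n -> ratfield R d) :
    Prop :=
  forall c : 'I_n -> ratfield R d, (forall t, ratfun_in s (c t)) ->
    \sum_t c t * f t = 0 -> forall t, c t = 0.

End RationalFunctions.

(* Main.v *)
(* Put y = x_pq and B = <mu,beta> = b0 + y b1, where b0, b1 do not involve y.
   The decomposition of the Gamma_j gives
   prodG = hatG_p * c * E(y) with E(y) = prod_{j != p} <(1,y), e_j>^d_j and c
   free of y. With n = m + 1 and N = A_pq E, equation (E) times
   Delta_pq * prodG has the pq-term
     c (B^2 N'' - 2 n B b1 N' + n (n+1) b1^2 N),
   while all its other terms are polynomials in y of degree at most ell. This
   term is c times the combination of
     N'',  2 y N'' - 2 n N',  y^2 N'' - 2 n y N' + n (n+1) N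
   with coefficients b0^2, b0 b1, b1^2. By the linear independence hypothesis
   the values of these coefficients on the box span R^3, so that the three
   functions of y are themselves polynomials of degree at most ell. Hence N is
   a polynomial, and a comparison of leading coefficients, in which ell < m is
   used, bounds its degree. *)

Require Import Defs.
From HB Require Import structures.
From mathcomp Require Import all_boot all_order all_algebra.
From mathcomp Require Import all_classical all_reals all_analysis.
From mathcomp Require Import (canonicals) mpoly.
From mathcomp Require Import (coercions) mpoly.
From mathcomp Require Import ring lra zify.
Set Implicit Arguments.
Unset Strict Implicit.
Unset Printing Implicit Defensive.
Import Order.TTheory GRing.Theory Num.Theory.
Import numFieldNormedType.Exports.
Local Open Scope classical_set_scope.
Local Open Scope ring_scope.

(** * Polynomials and derivatives in one variable *)

Section Univariate.
Variable R : realType.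
Implicit Types (f g : R -> R) (P Q : {poly R}) (I : set R).

(** A non-zero polynomial has fewer roots than its size, while a ball inside the open set contains
    arbitrarily many points. *)
Lemma poly_eq0_open I P :
  open I -> I !=set0 -> (forall y, I y -> P.[y] = 0) -> P = 0.
Proof.
move=> oI [a Ia] P0; apply/eqP/negPn/negP => Pn0.
have /nbhs_ballP[e /= e0 eI] : nbhs a I by exact: open_nbhs_nbhs.
(* The denominators start at 2, which keeps these distinct points strictly inside the ball of radius
   [e]. *)
pose rs := [seq a + e / (i.+2)%:R | i <- iota 0 (size P)].
have : (size rs < size P)%N.
  apply: max_poly_roots => //.
    apply/allP => _ /mapP[i _ ->]; apply/eqP/P0/eI.
    rewrite /ball /= opprD addrA subrr sub0r normrN gtr0_norm ?divr_gt0//.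
    by rewrite ltr_pdivrMr// ltr_pMr// ltr1n.
  rewrite map_inj_uniq ?iota_uniq// => i j /addrI/(mulfI (lt0r_neq0 e0)).
  by move=> /invr_inj/eqP; rewrite eqr_nat => /eqP[].
by rewrite size_map size_iota ltnn.
Qed.

Lemma poly_eq_open I P Q :
  open I -> I !=set0 -> (forall y, I y -> P.[y] = Q.[y]) -> P = Q.
Proof.
move=> oI nI PQ; apply/eqP; rewrite -subr_eq0; apply/eqP.
apply: (poly_eq0_open oI nI) => y /PQ.
by rewrite hornerD hornerN => ->; rewrite subrr.
Qed.

(** Turns an analytic derivative into a formal one: two polynomials that agree on a non-empty open
    set are equal. *)
Lemma deriv_eq_open I P Q f :
  open I -> I !=set0 -> (forall y, I y -> f y = P.[y]) ->
  (forall y, I y -> is_derive y 1 f Q.[y]) -> Q = P^`().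
Proof.
move=> oI nI fP fQ; apply: (poly_eq_open oI nI) => y Iy.
have h : is_derive y 1 (horner P) Q.[y].
  apply: near_eq_is_derive (fQ y Iy).
  by near=> z; rewrite fP//; near: z; exact: open_nbhs_nbhs.
by case: h => _ <-; rewrite derive_val.
Unshelve. all: by end_near. Qed.

(* The leading coefficients of the three polynomials below are
   D(D-1), 2D(D-n-1) and (D-n)(D-n-1) times that of Q, where D = deg Q. *)
Lemma size_le_of_derivatives (n l : nat) Q : (l.+1 < n)%N ->
  (size Q^`()^`() <= l.+1)%N ->
  (size (('X * Q^`()^`()) *+ 2 - Q^`() *+ (2 * n))%R <= l.+1)%N ->
  (size ('X^2 * Q^`()^`() - ('X * Q^`()) *+ (2 * n) + Q *+ (n * n.+1))%R
     <= l.+1)%N ->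
  (size Q <= l.+1)%N.
Proof.
move=> ln s0 s1 s2.
have K t P : (size P <= l.+1)%N -> (l < t)%N -> P`_t = 0.
  by move=> sP lt; rewrite nth_default// (leq_trans sP).
(* The first polynomial excludes the degrees from l+3 on, the second l+2 and the third l+1. The
   factors l+1-n and (l+1-n)(l-n) met in the last two cases are non-zero since l+1 < n. *)
have c0 D : (l < D)%N -> Q`_D.+2 = 0.
  move=> lD; have := K _ _ s0 lD; rewrite !coef_deriv -mulrnA => /eqP.
  by rewrite mulrn_eq0 muln_eq0 /= => /eqP.
have c1 : Q`_l.+2 = 0.
  have := K _ _ s1 (ltnSn l).
  rewrite coefB !coefMn !coef_deriv coefXM /= !coef_deriv -!mulrnA.
  rewrite -[_ *+ _]mulr_natr -[X in _ - X]mulr_natr -mulrBr => /eqP.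
  rewrite mulf_eq0 => /orP[/eqP//|]; rewrite subr_eq0 eqr_nat => /eqP h.
  exfalso; move: ln h; nia.
have c2 : Q`_l.+1 = 0.
  have := K _ _ s2 (ltnSn l).
  rewrite coefD coefB !coefMn coefXnM coefXM /=.
  have -> : (if (l.+1 < 2)%N then 0 else Q^`()^`()`_(l.+1 - 2)) =
            Q`_l.+1 *+ (l * l.+1).
    case: l {ln s0 s1 s2 K c0 c1} => // l.
    by rewrite subn2 /= !coef_deriv -mulrnA mulnC.
  rewrite coef_deriv -mulrnA addrAC -mulrnDr => /eqP.
  rewrite subr_eq0 -[_ *+ _]mulr_natr -[eqbRHS]mulr_natr -subr_eq0 -mulrBr.
  rewrite mulf_eq0.
  case/orP => [/eqP//|]; rewrite subr_eq0 eqr_nat => /eqP h.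
  exfalso; move: ln h; nia.
apply/leq_sizeP => j; rewrite leq_eqVlt => /orP[/eqP<-//|].
rewrite leq_eqVlt => /orP[/eqP<-//|]; case: j => [|[|j]]// lj; exact: c0.
Qed.

(** The three relations are triangular in [f2], [f1], [f], so [f] is a polynomial. A priori its
    degree may reach l+2; the relations between [f], [f1], [f2] as derivatives lower this to l. *)
Lemma polynomial_of_derivatives (n l : nat) I f f1 f2 (P0 P1 P2 : {poly R}) :
  (l.+1 < n)%N -> open I -> I !=set0 ->
  (forall y, I y -> is_derive y 1 f (f1 y)) ->
  (forall y, I y -> is_derive y 1 f1 (f2 y)) ->
  (size P0 <= l.+1)%N -> (size P1 <= l.+1)%N -> (size P2 <= l.+1)%N ->
  (forall y, I y -> f2 y = P0.[y]) ->
  (forall y, I y -> 2 * y * f2 y - (2 * n)%:R * f1 y = P1.[y]) ->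
  (forall y, I y ->
     y ^+ 2 * f2 y - (2 * n)%:R * y * f1 y + (n * n.+1)%:R * f y = P2.[y]) ->
  exists2 Q : {poly R}, (size Q <= l.+1)%N & forall y, I y -> f y = Q.[y].
Proof.
move=> ln oI nI df df1 s0 s1 s2 E0 E1 E2.
have n0 : (2 * n)%:R != 0 :> R by rewrite pnatr_eq0; lia.
have n1 : (n * n.+1)%:R != 0 :> R by rewrite pnatr_eq0; lia.
(* [Q1] solves the second relation for [f1], and [Q] then solves the third for [f]. *)
pose Q1 := (2 * n)%:R^-1 *: ('X * P0 *+ 2 - P1).
pose Q := (n * n.+1)%:R^-1 *: (P2 - 'X^2 * P0 + 'X * Q1 *+ (2 * n)).
have fQ1 y : I y -> f1 y = Q1.[y].
  move=> Iy; rewrite !hornerE -E0// -E1//.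
  by apply: (mulfI n0); rewrite mulVKf//; ring.
have fQ y : I y -> f y = Q.[y].
  move=> Iy; rewrite hornerZ hornerD hornerMn hornerM hornerX -fQ1//.
  rewrite !hornerE -E0// -E2//.
  by apply: (mulfI n1); rewrite mulVKf// -mulr_natr; ring.
have Q1E : Q1 = Q^`().
  apply: (deriv_eq_open oI nI fQ) => y Iy; rewrite -fQ1//; exact: df.
have P0E : P0 = Q1^`().
  apply: (deriv_eq_open oI nI fQ1) => y Iy; rewrite -E0//; exact: df1.
exists Q => //; apply: (size_le_of_derivatives ln).
- by rewrite -Q1E -P0E.
- rewrite -Q1E -P0E (_ : _ - _ = P1)//.
  by rewrite -[Q1 *+ _]scaler_nat scalerA mulfV// scale1r opprB addrC subrK.
- rewrite -Q1E -P0E (_ : _ + _ = P2)//.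
  by rewrite -[Q *+ _]scaler_nat scalerA mulfV// scale1r; ring.
Qed.

Lemma derive1n2_mul (I : set R) f g y : open I -> I y ->
  (forall n z, (n < 2)%N -> I z -> derivable (derive1n n f) z 1) ->
  (forall n z, (n < 2)%N -> I z -> derivable (derive1n n g) z 1) ->
  derive1n 2 (fun z => f z * g z) y =
  \sum_(t < 3) derive1n t f y * 'C(2, t)%:R * derive1n (2 - t) g y.
Proof.
move=> oI Iy df dg.
have D1 z : I z -> derive1 (fun z => f z * g z) z =
    f z * derive1 g z + derive1 f z * g z.
  move=> Iz; rewrite !derive1E [LHS](deriveM (df 0%N z isT Iz) (dg 0%N z isT Iz)).
  by congr (_ + _); rewrite /GRing.scale /= mulrC.
rewrite !big_ord_recl big_ord0 /= addr0 derive1E.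
(* The product rule holds on all of the open set, so its right-hand side may be differentiated once
   more at [y]. *)
rewrite (@near_eq_derive _ _ _ _
  ((fun z => f z * derive1 g z) + (fun z => derive1 f z * g z))); last first.
  by near=> z; rewrite D1//; near: z; exact: open_nbhs_nbhs.
have [d0 d1] := (df 0%N y isT Iy, df 1%N y isT Iy).
have [e0 e1] := (dg 0%N y isT Iy, dg 1%N y isT Iy).
rewrite deriveD; [|exact: derivableM d0 e1|exact: derivableM d1 e0].
rewrite (deriveM d0 e1) (deriveM d1 e0) -!derive1E /GRing.scale /=.
rewrite /bump /= !bin0 binn bin1 !mulr1; ring.
Unshelve. all: by end_near. Qed.

End Univariate.

(** A proper subspace is annihilated by a non-zero column. The subspace is a mere predicate, so it
    is first realized as the row space of a matrix of maximal rank. *)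
Lemma subspace_full (F : fieldType) (n : nat) (W : 'rV[F]_n -> Prop) :
  W 0 -> (forall a u v, W u -> W v -> W (a *: u + v)) ->
  (forall c : 'cV_n, (forall v, W v -> v *m c = 0) -> c = 0) ->
  forall v, W v.
Proof.
move=> W0 Wlin Wperp.
have Wsum (J : finType) (a : J -> F) (u : J -> 'rV_n) :
    (forall j, W (u j)) -> W (\sum_j a j *: u j).
  move=> Wu; elim/big_rec: _ => // j v _ Wv; exact: Wlin.
pose good r :=
  `[< exists2 M : 'M[F]_n, \rank M = r & forall v, (v <= M)%MS -> W v >].
have g0 : exists r, good r.
  exists 0%N; apply/asboolP; exists 0; first exact: mxrank0.
  by move=> v; rewrite submx0 => /eqP->.
have gn r : good r -> (r <= n)%N by move=> /asboolP[M <- _]; exact: rank_leq_row.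
case: (ex_maxnP g0 gn) => r /asboolP[M rM WM] rmax.
have Wsub v : W v -> (v <= M)%MS.
  (* A vector of [W] outside the row space of [M] could be added to [M], against the maximality of
     the rank. *)
  move=> Wv; apply: contraT => vM.
  have : good (\rank (M + v)%MS).
    apply/asboolP; exists (M + v)%MS => // w /sub_addsmxP[[a b] /= ->].
    rewrite addrC [b]mx11_scalar mul_scalar_mx; apply: Wlin => //.
    by apply: WM; exact: submxMl.
  move=> /rmax; rewrite -rM leqNgt => /negP[].
  by rewrite (ltn_leqif (mxrank_leqif_sup (addsmxSl _ _))) addsmx_sub submx_refl.
(* The columns of the cokernel annihilate the row space of [M], hence [W]. *)
have K0 : cokermx M = 0.
  apply/matrixP => i j; rewrite mxE; have /colP/(_ i) : col j (cokermx M) = 0.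
    apply: Wperp => v /Wsub; rewrite colE mulmxA submxE => /eqP->.
    exact: mul0mx.
  by rewrite !mxE.
by move=> v; apply: WM; rewrite submxE K0 mulmx0.
Qed.

(** * Evaluation of tensors and polynomials *)

Section Substitution.
Variables (k : nat) (d : 'I_k -> nat).
Implicit Types s t : slot d.

(** The update [upd] with values in any type, since it is also applied to families of
    polynomials. *)
Definition dfw (F : Type) (x : slot d -> F) s (y : F) : slot d -> F :=
  @dfwith _ (fun=> F) x s y.

Lemma dfw_in (F : Type) (x : slot d -> F) s y : dfw x s y s = y.
Proof. exact: (@dfwith_in _ (fun=> F)). Qed.

Lemma dfw_out (F : Type) (x : slot d -> F) s y t : s != t -> dfw x s y t = x t.
Proof. exact: (@dfwith_out _ (fun=> F)). Qed.

Lemma dfwE (F : Type) (x : slot d -> F) s y t :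
  dfw x s y t = if t == s then y else x t.
Proof.
by case: eqVneq => [->|ts]; [exact: dfw_in|rewrite dfw_out// eq_sym].
Qed.

Lemma dfw_id (F : Type) (x : slot d -> F) s : dfw x s (x s) = x.
Proof. by apply/funext => t; rewrite dfwE; case: eqP => [->|]. Qed.

Lemma dfw_dfw (F : Type) (x : slot d -> F) s y z :
  dfw (dfw x s y) s z = dfw x s z.
Proof. by apply/funext => t; rewrite !dfwE; case: eqP. Qed.

Variables (R : realType).

Lemma eq_pairing (F : comNzRingType) (c c' : R -> F) (G : {set 'I_k})
    (x x' : slot d -> F) (T : tensor R (slots d G)) :
  c =1 c' -> (forall s, tag s \in G -> x s = x' s) ->
  pairing c x T = pairing c' x' T.
Proof.
move=> cc xx; apply: eq_bigr => a _; rewrite cc; congr (_ * _).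
by apply: eq_bigr => s _; rewrite xx//; exact: (valP s).
Qed.

Lemma rmorph_pairing (F F' : comNzRingType) (g : {rmorphism F -> F'})
    (c : R -> F) (G : {set 'I_k}) (x : slot d -> F) (T : tensor R (slots d G)) :
  g (pairing c x T) = pairing (g \o c) (g \o x) T.
Proof.
rewrite rmorph_sum; apply: eq_bigr => a _; rewrite rmorphM rmorph_prod.
congr (_ * _); apply: eq_bigr => s _.
by rewrite !mxE rmorphXn.
Qed.

(** In the term of the multi-index [a], the variable at s has exponent [a u], which is 0 or 1; it is
    absent if s is not a slot of [G]. *)
Lemma pairing_dfw_affine (F : comNzRingType) (c : R -> F) (G : {set 'I_k})
    (x : slot d -> F) (T : tensor R (slots d G)) s y :
  pairing c (dfw x s y) T = pairing c (dfw x s 0) T +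
    y * (pairing c (dfw x s 1) T - pairing c (dfw x s 0) T).
Proof.
rewrite /pairing -sumrB mulr_sumr -big_split /=; apply: eq_bigr => a _.
rewrite -mulrBl mulrA -mulrDl; congr (_ * _).
have [sG|sG] := boolP (tag s \in G); last first.
  have E z : \prod_(t : slots d G) pt (dfw x s z (val t)) 0 (a t) =
      \prod_(t : slots d G) pt (x (val t)) 0 (a t).
    apply: eq_bigr => t _; rewrite dfw_out//.
    by apply: contraNneq sG => ->; exact: (valP t).
  by rewrite !E subrr mulr0 addr0.
pose u : slots d G := Sub s sG.
have E z : \prod_(t : slots d G) pt (dfw x s z (val t)) 0 (a t) =
    z ^+ a u * \prod_(t : slots d G | t != u) pt (x (val t)) 0 (a t).
  rewrite (bigD1 u)//= mxE dfw_in; congr (_ * _); apply: eq_bigr => t tu.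
  by rewrite dfw_out//; apply: contraNneq tu => su; apply/eqP/val_inj.
rewrite !E; case: (a u) => [[|[|//]] ?] /=; ring.
Qed.

End Substitution.

Section Evaluation.
Variables (R : realType) (k : nat) (d : 'I_k -> nat).
Implicit Types (s t : slot d) (x : slot d -> R) (P Q : polyring R d).

Definition ev x : polyring R d -> R := mpoly.meval (fun i => x (enum_val i)).

(* P as a polynomial in x_s, the other variables having the values x. *)
Definition uni s x : polyring R d -> {poly R} :=
  mpoly.mmap polyC (fun i => dfw (fun t => (x t)%:P) s 'X (enum_val i)).

HB.instance Definition _ x := GRing.RMorphism.on (ev x).
HB.instance Definition _ s x := GRing.RMorphism.on (uni s x).

Lemma ev_X x s : ev x (Xvar R s) = x s.
Proof. by rewrite /ev mpoly.mevalXU enum_rankK. Qed.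

Lemma ev_C x c : ev x (mpoly.mpolyC _ c) = c.
Proof. exact: mpoly.mevalC. Qed.

Lemma uni_X s x t : uni s x (Xvar R t) = dfw (fun t => (x t)%:P) s 'X t.
Proof. by rewrite /uni mpoly.mmapX mpoly.mmap1U enum_rankK. Qed.

Lemma uni_C s x c : uni s x (mpoly.mpolyC _ c) = c%:P.
Proof. exact: mpoly.mmapC. Qed.

Lemma ev_pairing x (G : {set 'I_k}) (T : tensor R (slots d G)) :
  ev x (pairing (@mpoly.mpolyC _ R) (@Xvar R _ d) T) = pairing id x T.
Proof.
rewrite rmorph_pairing; apply: eq_pairing => [c|s _] /=; first exact: ev_C.
exact: ev_X.
Qed.

Lemma horner_uni s x y P : (uni s x P).[y] = ev (dfw x s y) P.
Proof.
rewrite /uni /ev /mpoly.mmap /mpoly.meval /mpoly.mmap horner_sum.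
apply: eq_bigr => m _; rewrite hornerM hornerC horner_prod; congr (_ * _).
apply: eq_bigr => i _; rewrite horner_exp; congr (_ ^+ _).
by rewrite !dfwE; case: eqP => _; rewrite ?hornerX ?hornerC.
Qed.

Lemma uni_dfw s x y P : uni s (dfw x s y) P = uni s x P.
Proof.
congr (mpoly.mmap _ _ _); apply/funext => i; rewrite !dfwE.
by case: eqP.
Qed.

Lemma uni_pairing s x (G : {set 'I_k}) (T : tensor R (slots d G)) :
  uni s x (pairing (@mpoly.mpolyC _ R) (@Xvar R _ d) T) =
  pairing polyC (dfw (fun t => (x t)%:P) s 'X) T.
Proof.
rewrite rmorph_pairing; apply: eq_pairing => [c|t _] /=; first exact: uni_C.
exact: uni_X.
Qed.

Lemma partialX_X s t : partialX s (Xvar R t) = (s == t)%:R.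
Proof.
rewrite /partialX /Xvar mpoly.mderivX mpoly.mnm1E (inj_eq enum_rank_inj) eq_sym.
case: eqP => [->|_]; last by rewrite scale0r.
rewrite scale1r -[1]mpoly.mpolyX0; congr mpoly.mpolyX.
by apply/mpoly.mnmP => i; rewrite mpoly.mnmBE subnn mpoly.mnm0E.
Qed.

Lemma partialXM s P Q :
  partialX s (P * Q) = partialX s P * Q + P * partialX s Q.
Proof. exact: mpoly.mderivM. Qed.

(** Serves for properties of [uni] that are stable under sums and products. *)
Lemma polyring_ind (K : polyring R d -> Prop) :
  (forall c, K (mpoly.mpolyC _ c)) -> (forall s, K (Xvar R s)) ->
  (forall P Q, K P -> K Q -> K (P + Q)) ->
  (forall P Q, K P -> K Q -> K (P * Q)) -> forall P, K P.
Proof.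
move=> KC KX KD KM; elim/mpoly.mpolyind => [|c m P _ _ KP].
  by rewrite -[0](mpoly.mpolyC0 #|{: slot d}| R); exact: KC.
apply: (KD _ _ _ KP); rewrite -mpoly.mul_mpolyC; apply: (KM _ _ (KC c)).
have K1 : K 1 by exact: KC 1.
rewrite mpoly.mpolyXE_id; elim/big_ind: _ => // i _.
elim: (m i) => [|n IH]; first by rewrite expr0.
rewrite exprS; apply: (KM _ _ _ IH).
by have := KX (enum_val i); rewrite /Xvar enum_valK.
Qed.

Lemma deriv_uni s x P : (uni s x P)^`() = uni s x (partialX s P).
Proof.
elim/polyring_ind: P => [c|t|P Q IP IQ|P Q IP IQ].
- by rewrite uni_C derivC /partialX mpoly.mderivC rmorph0.
- rewrite uni_X partialX_X dfwE eq_sym rmorph_nat.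
  by case: eqP => _; rewrite ?derivX ?derivC.
- by rewrite /partialX mpoly.mderivD !rmorphD derivD IP IQ.
- by rewrite partialXM rmorphD !rmorphM derivM IP IQ.
Qed.

(** Induction on a degree bound: the partial derivatives vanish on the box too and have smaller
    degree, so they are zero. Then P is constant, with value 0 at a point of the box. *)
Lemma mpoly_eq0_box (J : slot d -> set R) P :
  (forall s, open (J s)) -> (forall s, J s !=set0) ->
  (forall x, (forall s, J s (x s)) -> ev x P = 0) -> P = 0.
Proof.
move=> oJ nJ.
have [n] : exists n, forall m, (n <= mpoly.mdeg m)%N -> mpoly.mcoeff m P = 0.
  exists (mpoly.msize P) => m; move/mpoly.msize_mdeg_ge.
  exact: mpoly.memN_msupp_eq0.
elim: n P => [|n IH] P Pn P0.
  by apply/mpoly.mpolyP => m; rewrite Pn// mpoly.mcoeff0.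
have dP s : partialX s P = 0.
  apply: IH => [m nm|x Jx].
    by rewrite mpoly.mcoeff_deriv Pn ?mul0rn// mpoly.mdegD mpoly.mdeg1 addn1.
  rewrite -[x](dfw_id x s) -horner_uni -deriv_uni [uni _ _ _](_ : _ = 0).
    by rewrite deriv0 horner0.
  apply: (poly_eq0_open (oJ s) (nJ s)) => y Jy; rewrite horner_uni P0// => t.
  by rewrite dfwE; case: eqP => [->|].
(* In characteristic 0, a monomial that contains a variable is still visible in the derivative by
   that variable. *)
have PC : P = mpoly.mpolyC _ (mpoly.mcoeff mpoly.mnm0 P).
  apply/mpoly.mpolyP => m; rewrite mpoly.mcoeffC.
  have [->|m0] := eqVneq m mpoly.mnm0; first by rewrite mulr1.
  rewrite mulr0; have [i mi] : exists i, m i != 0%N.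
    apply/existsP; apply: contraNT m0; rewrite negb_exists => /forallP m0.
    apply/eqP/mpoly.mnmP => i; rewrite mpoly.mnm0E.
    by apply/eqP; have := m0 i; rewrite negbK.
  have := congr1 (mpoly.mcoeff (mpoly.mnm_sub m (mpoly.mnm1 i)))
    (dP (enum_val i)).
  rewrite /partialX enum_valK mpoly.mcoeff_deriv mpoly.mcoeff0.
  rewrite mpoly.submK ?mpoly.lep1mP// => /eqP.
  by rewrite mulrn_eq0 /= => /eqP.
rewrite PC [mpoly.mcoeff _ _](_ : _ = 0) ?mpoly.mpolyC0//.
rewrite -[LHS](ev_C (fun s => xget 0 (J s))) -PC P0// => s.
by have [y Jy] := nJ s; apply: xgetPex; exists y.
Qed.

(* If f = P / B^n, then the derivative of f by x_s is
   (quot_step s B n P) / B^(n+1). *)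
Definition quot_step s B n P : polyring R d :=
  partialX s P * B - (P * partialX s B) *+ n.

(** After j' differentiations the denominator is B^(n+j'), whence the exponent passed to
    [quot_step]. *)
Fixpoint quot_iter s B n j P : polyring R d :=
  if j is j'.+1 then quot_step s B (n + j') (quot_iter s B n j' P) else P.

Lemma is_derive_quot s x B n P y : ev (dfw x s y) B != 0 ->
  is_derive y 1 (fun z => ev (dfw x s z) P / ev (dfw x s z) B ^+ n)
    (ev (dfw x s y) (quot_step s B n P) / ev (dfw x s y) B ^+ n.+1).
Proof.
have -> : (fun z => ev (dfw x s z) P / ev (dfw x s z) B ^+ n) =
    horner (uni s x P) * (fun z => (horner (uni s x B ^+ n) z)^-1).
  by apply/funext => z; rewrite /= !fctE horner_exp !horner_uni.
rewrite -horner_uni => B0.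
have Bn0 : (uni s x B ^+ n).[y] != 0 by rewrite horner_exp expf_neq0.
have dV : is_derive y 1 (fun z => (horner (uni s x B ^+ n) z)^-1)
    (- (uni s x B ^+ n).[y] ^- 2 *: (uni s x B ^+ n)^`().[y]).
  apply: DeriveDef; first exact: derivableV.
  by rewrite deriveV//; congr (_ *: _); exact: derive_val.
apply: is_derive_eq (is_deriveM (is_derive_poly _ _) dV) _.
rewrite /GRing.scale /= -!horner_uni /quot_step rmorphB rmorphMn !rmorphM /=.
rewrite -!deriv_uni.
rewrite deriv_exp !hornerE !hornerMn !hornerM horner_exp /=.
move: (uni s x P).[y] (uni s x P)^`().[y] (uni s x B)^`().[y] => p p' b'.
move: (uni s x B).[y] B0 => b b0.
case: n {Bn0 dV} => [|n]; first by rewrite !mulr0n expr0 expr1 expr1n; field.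
rewrite -[b' * _ *+ _]mulr_natr -[p * _ *+ _]mulr_natr /= !exprS.
move: (b ^+ n) (expf_neq0 n b0) => c c0; field; exact/andP.
Qed.

Lemma derive1n_quot s x B n P j y : ev (dfw x s y) B != 0 ->
  let f z := ev (dfw x s z) P / ev (dfw x s z) B ^+ n in
  derivable (derive1n j f) y 1 /\
  derive1n j f y =
    ev (dfw x s y) (quot_iter s B n j P) / ev (dfw x s y) B ^+ (n + j).
Proof.
move=> + f; pose g i z :=
  ev (dfw x s z) (quot_iter s B n i P) / ev (dfw x s z) B ^+ (n + i).
have Bnear z : ev (dfw x s z) B != 0 -> \near z, ev (dfw x s z) B != 0.
  rewrite -horner_uni => Bz; near=> w; rewrite -horner_uni; near: w.
  by apply: cvgr_neq0 Bz; exact: continuous_horner.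
(* The induction runs over all points where B does not vanish: the next derivative at [z] needs the
   formula on a neighbourhood, and this condition is open. *)
have main i z : ev (dfw x s z) B != 0 -> derive1n i f z = g i z /\
    is_derive z 1 (derive1n i f) (g i.+1 z).
  elim: i z => [|i IH] z Bz.
    rewrite /g addn0 addn1 /=; split=> //.
    by rewrite /quot_iter /= addn0; exact: is_derive_quot.
  have E w : ev (dfw x s w) B != 0 -> derive1n i.+1 f w = g i.+1 w.
    by move=> /IH[_ ?]; rewrite derive1nS derive1E derive_val.
  split; first exact: E.
  apply: (@near_eq_is_derive _ _ _ (g i.+1)).
    by near=> w; apply/esym/E; near: w; exact: Bnear.
  have := is_derive_quot (n + i.+1) (quot_iter s B n i.+1 P) Bz.
  by rewrite -addnS.
move=> By; have [-> dj] := main j y By; split=> //; exact: ex_derive.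
Unshelve. all: by end_near. Qed.

Lemma quot_iterC s B n j c P :
  quot_iter s B n j (mpoly.mpolyC _ c * P) =
  mpoly.mpolyC _ c * quot_iter s B n j P.
Proof.
elim: j => //= j ->; rewrite /quot_step /partialX mpoly.mderiv_mulC.
by rewrite mulrBr mulrA -mulrA -mulrnAr.
Qed.

(** The bound is uniform in the other variables, as [xdeg_le] requires. *)
Lemma size_uni_bounded s P : exists n, forall x, (size (uni s x P) <= n.+1)%N.
Proof.
elim/polyring_ind: P => [c|t|P Q [n Pn] [n' Qn]|P Q [n Pn] [n' Qn]].
- by exists 0%N => x; rewrite uni_C size_polyC; case: eqP.
- exists 1%N => x; rewrite uni_X dfwE; case: eqP => _; rewrite ?size_polyX//.
  by rewrite size_polyC; case: eqP.
- exists (maxn n n') => x; rewrite rmorphD (leq_trans (size_polyD _ _))//.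
  rewrite -maxnSS geq_max !leq_max.
  by have := Pn x; have := Qn x; rewrite /= => -> ->; rewrite orbT.
- exists (n + n')%N => x; rewrite rmorphM (leq_trans (size_polyMleq _ _))//.
  by have := Pn x; have := Qn x; rewrite /=; lia.
Qed.

End Evaluation.

(** * Degree in one of the variables *)

Section Structure.
Variables (R : realType) (k : nat) (d : 'I_k -> nat).
Variable Gamma : forall j, tensor R (slots d (groups k :\ j)).
Variable beta : tensor R (slots d (groups k)).
Implicit Types (s t pq : slot d) (x : slot d -> R).
Implicit Types f g : (slot d -> R) -> R.

Local Notation m := (\sum_j d j)%N.
Local Notation hatG := (hatG Gamma).
Local Notation prodG := (prodG Gamma).
Local Notation regular := (regular Gamma beta).
Local Notation xdeg_le := (xdeg_le Gamma beta).

Lemma updE x s y t : upd x s y t = if t == s then y else x t.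
Proof. exact: dfwE. Qed.

Lemma upd_upd x s y z : upd (upd x s y) s z = upd x s z.
Proof. exact: dfw_dfw. Qed.

Lemma upd_id x s : upd x s (x s) = x.
Proof. exact: dfw_id. Qed.

(** Gathers the coefficients into one polynomial, so that degrees can be estimated through
    [size]. *)
Lemma xdeg_leP pq n f : xdeg_le pq n f <-> exists F : (slot d -> R) -> {poly R},
  [/\ forall x y, F (upd x pq y) = F x, forall x, (size (F x) <= n.+1)%N
    & forall x, regular x -> f x = (F x).[x pq]].
Proof.
split=> [[a ainv fa]|[F [Finv Fs fF]]].
  exists (fun x => \poly_(i < n.+1) a (inord i) x); split=> [x y|x|x rx].
  - by apply/polyP => i; rewrite !coef_poly ainv.
  - exact: size_poly.
  - rewrite fa// horner_poly; apply: eq_bigr => i _.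
    by rewrite inord_val.
exists (fun i x => (F x)`_i) => [i x y|x rx]; first by rewrite Finv.
by rewrite fF// (horner_coef_wide _ (Fs x)).
Qed.

Lemma eq_xdeg_le pq n f g : (forall x, regular x -> f x = g x) ->
  xdeg_le pq n g -> xdeg_le pq n f.
Proof. by move=> fg [a ainv ga]; exists a => // x rx; rewrite fg// ga. Qed.

Lemma xdeg_le_trans pq n n' f :
  (n <= n')%N -> xdeg_le pq n f -> xdeg_le pq n' f.
Proof.
move=> nn /xdeg_leP[F [Finv Fs fF]]; apply/xdeg_leP; exists F; split=> // x.
exact: leq_trans (Fs x) _.
Qed.

Lemma xdeg_leM pq n n' f g : xdeg_le pq n f -> xdeg_le pq n' g ->
  xdeg_le pq (n + n') (fun x => f x * g x).
Proof.
move=> /xdeg_leP[F [Finv Fs fF]] /xdeg_leP[G [Ginv Gs gG]]; apply/xdeg_leP.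
exists (fun x => F x * G x); split=> [x y|x|x rx].
- by rewrite Finv Ginv.
- rewrite (leq_trans (size_polyMleq _ _))//.
  by have := Fs x; have := Gs x; lia.
- by rewrite hornerM fF// gG.
Qed.

Lemma xdeg_le_const pq f : (forall x y, f (upd x pq y) = f x) -> xdeg_le pq 0 f.
Proof.
move=> finv; exists (fun _ => f) => // x _.
by rewrite big_ord1 expr0 mulr1.
Qed.

Lemma xdeg_le_affine pq f :
  (forall x, f x = f (upd x pq 0) + x pq * (f (upd x pq 1) - f (upd x pq 0))) ->
  xdeg_le pq 1 f.
Proof.
move=> faff; apply/xdeg_leP.
exists (fun x => (f (upd x pq 0))%:P + (f (upd x pq 1) - f (upd x pq 0)) *: 'X).
split=> [x y|x|x _].
- by rewrite !upd_upd.
- rewrite (leq_trans (size_polyD _ _))// geq_max size_polyC.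
  rewrite (leq_trans (size_scale_leq _ _)) ?size_polyX// andbT.
  by case: eqP.
- by rewrite hornerD hornerC hornerZ hornerX mulrC -faff.
Qed.

Lemma xdeg_le_ev pq P : exists n, xdeg_le pq n (fun x => ev x P).
Proof.
have [n Pn] := size_uni_bounded pq P; exists n; apply/xdeg_leP.
exists (fun x => uni pq x P); split=> // [x y|x _]; first exact: uni_dfw.
by rewrite horner_uni dfw_id.
Qed.

(** The tensor [Gamma (tag s)] has no slot in the group of s. *)
Lemma hatG_upd x s y : hatG (upd x s y) (tag s) = hatG x (tag s).
Proof.
apply: eq_pairing => // t; rewrite !inE andbT => ts.
by rewrite updE; case: eqP => // e; rewrite e eqxx in ts.
Qed.

Definition hatGX (i : 'I_k) : polyring R d :=
  pairing (@mpoly.mpolyC _ R) (@Xvar R _ d) (Gamma i).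

Definition prodGX : polyring R d := \prod_(b < k) hatGX b ^+ d b.

(* prodG divided by hatG x i *)
Definition coprodGX (i : 'I_k) : polyring R d :=
  hatGX i ^+ (d i).-1 * \prod_(b < k | b != i) hatGX b ^+ d b.

Lemma prodG_coprod x s : prodG x = hatG x (tag s) * ev x (coprodGX (tag s)).
Proof.
have -> : prodG x = ev x prodGX.
  rewrite rmorph_prod; apply: eq_bigr => b _; rewrite rmorphXn /=.
  by rewrite ev_pairing.
rewrite -[hatG _ _]ev_pairing -rmorphM; congr (ev x _).
rewrite /prodGX (bigD1 (tag s))//= /coprodGX mulrA -exprS prednK//.
by case: s => i [r /= /(leq_ltn_trans (leq0n _))].
Qed.

Definition DeltaX s : polyring R d :=
  \prod_(r : 'I_(d (tag s)) | r != tagged s) (Xvar R s - Xvar R (mkslot r)).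

Lemma ev_DeltaX x s : ev x (DeltaX s) = Delta x s.
Proof.
rewrite rmorph_prod; apply: eq_bigr => r _.
by rewrite rmorphB /= !ev_X.
Qed.

Lemma ev_muX x alpha : ev x (muX alpha) = mu x alpha.
Proof. exact: ev_pairing. Qed.

(** One factor [hatG x (tag s)] of [prodG] is constant in x_s. It is kept outside the derivative in
    order to cancel the same factor in the denominator of [prefactor]. *)
Lemma partial_quot s x n j : regular x ->
  partial j s (fun z => prodG z / mu z beta ^+ n) x =
  hatG x (tag s) * ev x (quot_iter s (muX beta) n j (coprodGX (tag s)))
  / mu x beta ^+ (n + j).
Proof.
move=> [_ _ B0]; rewrite /partial.
have -> : (fun y => prodG (upd x s y) / mu (upd x s y) beta ^+ n) =
  (fun z => ev (dfw x s z) (mpoly.mpolyC _ (hatG x (tag s)) * coprodGX (tag s))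
     / ev (dfw x s z) (muX beta) ^+ n).
  apply/funext => y; rewrite (prodG_coprod _ s) hatG_upd.
  by rewrite [ev _ (_ * coprodGX _)]rmorphM /= ev_C ev_muX.
have [|_ ->] := @derive1n_quot _ _ _ s x (muX beta) n
  (mpoly.mpolyC _ (hatG x (tag s)) * coprodGX (tag s)) j (x s).
  by rewrite dfw_id ev_muX.
by rewrite dfw_id quot_iterC [ev _ (mpoly.mpolyC _ _ * _)]rmorphM /= ev_C ev_muX.
Qed.

End Structure.

(** * Slots filled with a decomposable tensor *)

Section Decomposition.
Variables (R : realType) (k : nat) (d : 'I_k -> nat).

(** Group the multi-indices by their value at [u]. As [psi] does not see this value, every group
    contributes the same sum of [psi], represented by the value 0. *)
Lemma sum_ffun_coord (S : finType) (V : comNzRingType) (u : S) (phi : 'I_2 -> V)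
    (psi : {ffun S -> 'I_2} -> V) :
  (forall a b : {ffun S -> 'I_2},
     (forall v, v != u -> a v = b v) -> psi a = psi b) ->
  \sum_(a : {ffun S -> 'I_2}) phi (a u) * psi a =
    (\sum_t phi t) * \sum_(a : {ffun S -> 'I_2} | a u == ord0) psi a.
Proof.
move=> psi_u; pose put t (a : {ffun S -> 'I_2}) :=
  [ffun v => if v == u then t else a v].
rewrite (partition_big (fun a : {ffun S -> 'I_2} => a u) xpredT)//= mulr_suml.
apply: eq_bigr => t _; rewrite (reindex_onto (put t) (put ord0)); last first.
  move=> a /eqP au; apply/ffunP => v; rewrite !ffunE.
  by case: eqP => [->|].
rewrite mulr_sumr; apply: eq_big => [a|a _]; last first.
  rewrite ffunE eqxx; congr (_ * _); apply: psi_u => v vu.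
  by rewrite ffunE (negbTE vu).
rewrite ffunE !eqxx /=; apply/eqP/eqP => [<-|au]; first by rewrite ffunE eqxx.
by apply/ffunP => v; rewrite !ffunE; case: eqP => [->|].
Qed.

Lemma ins_tpowE (G : {set 'I_k}) (p : 'I_k) (U : tensor R (slots d (G :\ p)))
    (e : 'rV[R]_2) (a : {ffun slots d G -> 'I_2}) :
  ins U (tpow (d p) e) a =
  (\prod_(r < d p) e 0 (Defs.coord a (mkslot r))) *
  U [ffun s => Defs.coord a (val s)].
Proof.
rewrite !ffunE; congr (_ * _); apply: eq_bigr => r _; congr (e 0 _).
exact: ffunE.
Qed.

(** A decomposable factor in the grouped p-slots makes x_pq enter through one linear factor only;
    the remaining factor [h] is free of it. *)
Lemma pairing_ins_tpow (G : {set 'I_k}) (p : 'I_k) (q : 'I_(d p))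
    (U : tensor R (slots d (G :\ p))) (e : 'rV[R]_2) (x : slot d -> R) :
  p \in G -> exists h, forall y,
  pairing id (upd x (mkslot q) y) (ins U (tpow (d p) e)) = dot (pt y) e * h.
Proof.
move=> pG; pose u : slots d G := Sub (mkslot q) pG.
have cu (a : {ffun slots d G -> 'I_2}) : Defs.coord a (mkslot q) = a u.
  rewrite /Defs.coord; case: insubP => [v _ vs|/negP//].
  by congr (a _); exact: val_inj.
(* All factors that do not involve the coordinate of [a] at the slot (p,q); the slots of [U] lie
   outside the group p. *)
pose psi (a : {ffun slots d G -> 'I_2}) :=
  \prod_(s : slots d G | s != u) pt (x (val s)) 0 (a s) *
  (\prod_(r | r != q) e 0 (Defs.coord a (mkslot r)) *
   U [ffun s => Defs.coord a (val s)]).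
exists (\sum_(a : {ffun slots d G -> 'I_2} | a u == ord0) psi a) => y.
rewrite /dot -(@sum_ffun_coord _ _ u (fun t => pt y 0 t * e 0 t)); last first.
  move=> a b ab.
  have cab s : s != mkslot q -> Defs.coord a s = Defs.coord b s.
    move=> sq; rewrite /Defs.coord; case: insubP => // v _ vs; apply: ab.
    by apply: contraNneq sq => vu; rewrite -vs vu.
  congr (_ * (_ * _)).
  - by apply: eq_bigr => s /ab->.
  - apply: eq_bigr => r rq; rewrite cab//; apply: contraNneq rq.
    by move=> /eqP; rewrite eq_Tagged /= => /eqP->.
  - congr (U _); apply/ffunP => s; rewrite !ffunE cab//.
    have := valP s; rewrite !inE => /andP[+ _].
    by apply: contraNneq => ->.
apply: eq_bigr => a _; rewrite ins_tpowE (bigD1 u)//= (bigD1 q)//= cu.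
rewrite updE eqxx /psi !mulrA; congr (_ * _ * _).
rewrite [LHS]mulrAC; congr (_ * _).
apply: eq_bigr => s su; rewrite updE ifN//; apply: contraNneq su => sq.
Qed.

End Decomposition.

(** * The number ell *)

Section Bound.
Variables (R : realType) (k : nat) (d : 'I_k -> nat).
Variable Gamma : forall j, tensor R (slots d (groups k :\ j)).
Variable beta : tensor R (slots d (groups k)).
Implicit Types (s t pq : slot d) (x : slot d -> R).

Local Notation m := (\sum_j d j)%N.
Local Notation hatG := (hatG Gamma).
Local Notation prodG := (prodG Gamma).
Local Notation regular := (regular Gamma beta).
Local Notation xdeg_le := (xdeg_le Gamma beta).

(** For slots in different groups the denominator is free of x_pq. Within one group, its single
    factor with x_pq cancels against the numerator up to sign. *)
Lemma xdeg_le_Delta_ratio pq s : s != pq ->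
  exists n, xdeg_le pq n (fun x => Delta x pq / Delta x s).
Proof.
have [st spq|] := eqVneq (tag s) (tag pq); last first.
  move=> st _; have [n xn] := xdeg_le_ev Gamma beta pq (DeltaX R pq).
  exists (n + 0)%N.
  apply: (eq_xdeg_le (g := fun x => ev x (DeltaX R pq) * (Delta x s)^-1)).
    by move=> x _; rewrite ev_DeltaX.
  apply: xdeg_leM => //; apply: xdeg_le_const => x y; congr (_^-1).
  by apply: eq_bigr => r _; rewrite !updE !ifN//; apply: contraNneq st => <-.
case: pq s st spq => i q [i' r] /= ii; subst i'; rewrite eq_Tagged /= => rq.
pose P := \prod_(t < d i | (t != q) && (t != r))
  (Xvar R (mkslot q) - Xvar R (mkslot t)).
have [n xn] := xdeg_le_ev Gamma beta (mkslot q) P.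
(* The sign is the quotient of x_q - x_r by x_r - x_q. *)
pose Q x := - (\prod_(t < d i | (t != q) && (t != r))
  (x (mkslot r) - x (mkslot t)))^-1.
exists (n + 0)%N; apply: (eq_xdeg_le (g := fun x => ev x P * Q x)).
  move=> x [/(_ (mkslot r)) Dr _ _].
  have Er : Delta x (mkslot r) = (x (mkslot r) - x (mkslot q)) *
      \prod_(t < d i | (t != q) && (t != r)) (x (mkslot r) - x (mkslot t)).
    rewrite /Delta (bigD1 q) 1?eq_sym//=; congr (_ * _).
    by apply: eq_bigl => t; rewrite andbC.
  have Eq : Delta x (mkslot q) = (x (mkslot q) - x (mkslot r)) *
      \prod_(t < d i | (t != q) && (t != r)) (x (mkslot q) - x (mkslot t)).
    by rewrite /Delta (bigD1 r).
  rewrite Eq; move: Dr; rewrite Er mulf_eq0 => /norP[a0 b0].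
  have -> : ev x P = \prod_(t < d i | (t != q) && (t != r))
      (x (mkslot q) - x (mkslot t)).
    by rewrite rmorph_prod; apply: eq_bigr => t _; rewrite rmorphB /= !ev_X.
  rewrite /Q; move: b0 {Er Eq}; set b := \prod_(_ | _) _ => b0.
  set c := \prod_(_ | _) _.
  by field; rewrite b0 a0.
apply: xdeg_leM => //; apply: xdeg_le_const => x y; congr (- _^-1).
have K (t : 'I_(d i)) :
    t != q -> upd x (mkslot q) y (mkslot t) = x (mkslot t).
  by move=> tq; rewrite updE ifN// eq_Tagged.
by apply: eq_bigr => t /andP[tq _]; rewrite !K.
Qed.

Lemma prodG_neq0 x : regular x -> prodG x != 0.
Proof. by move=> [_ h _]; apply/prodf_neq0 => i _; exact: expf_neq0. Qed.

Lemma xdeg_le_coefE pq s (t : 'I_3) : s != pq ->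
  exists n, xdeg_le pq n (Defs.coefE Gamma beta pq s t).
Proof.
move=> /xdeg_le_Delta_ratio[n1 h1].
have [n2 h2] := xdeg_le_ev Gamma beta pq
  (quot_iter s (muX beta) (m + 1) (2 - t) (coprodGX Gamma (tag s)) *
   muX beta ^+ t * mpoly.mpolyC _ 'C(2, t)%:R).
exists (n1 + n2)%N; apply: eq_xdeg_le (xdeg_leM h1 h2) => x rx.
rewrite /Defs.coefE partial_quot// /prefactor [ev _ (_ * mpoly.mpolyC _ _)]rmorphM /=.
rewrite [ev _ (_ * _ ^+ _)]rmorphM rmorphXn /= ev_C ev_muX.
have G0 := prodG_neq0 rx; have [/(_ s) D0 /(_ (tag s)) H0 B0] := rx.
(* The power m+3 of <mu,beta> clears the denominator of the derivative of order 2-t and leaves the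
   power t. *)
have -> : (m + 3 = m + 1 + (2 - t) + t)%N by have := ltn_ord t; lia.
rewrite [_ ^+ (_ + t)]exprD; have := expf_neq0 (m + 1 + (2 - t)) B0.
move: (_ ^+ (m + 1 + (2 - t))) => b b0; field.
by rewrite G0 D0 H0 b0.
Qed.

Lemma xdeg_le_rhsE pq : exists n, forall alpha,
  xdeg_le pq n (rhsE Gamma pq alpha).
Proof.
have [n hn] := xdeg_le_ev Gamma beta pq (DeltaX R pq * prodGX Gamma).
exists (n + 1)%N => alpha.
apply: (eq_xdeg_le (g := fun x => ev x (DeltaX R pq * prodGX Gamma) * mu x alpha)).
  move=> x _; rewrite rmorphM /= ev_DeltaX /rhsE; congr (_ * _ * _).
  rewrite rmorph_prod; apply: eq_bigr => b _; rewrite rmorphXn /=.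
  by rewrite ev_pairing.
apply: xdeg_leM => //; apply: xdeg_le_affine => x.
by rewrite -[in LHS](upd_id x pq); exact: pairing_dfw_affine.
Qed.

(** Excludes the default value of [xget]: finitely many coefficients and a bound uniform in alpha
    give some upper bound, hence a least one. *)
Lemma ell_boundP pq : ell_bound Gamma beta pq (ell Gamma beta pq).
Proof.
have [n0 hn0] : exists n, ell_bound Gamma beta pq n.
  have [n1 h1] := xdeg_le_rhsE pq.
  have /choice[N hN] (st : slot d * 'I_3) :
      exists n, st.1 != pq -> xdeg_le pq n (Defs.coefE Gamma beta pq st.1 st.2).
    have [->|spq] := eqVneq st.1 pq; first by exists 0%N => /eqP.
    by have [n h] := xdeg_le_coefE st.2 spq; exists n.
  exists (maxn n1 (\max_st N st)); split=> [s t spq|alpha _].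
    apply: xdeg_le_trans (hN (s, t) spq); rewrite leq_max; apply/orP; right.
    exact: leq_bigmax.
  by apply: xdeg_le_trans (h1 alpha); rewrite leq_max leqnn.
have ex : exists n, `[< ell_bound Gamma beta pq n >] by exists n0; exact/asboolP.
case: (ex_minnP ex) => n /asboolP bn min_n.
suff [] : [set n | ell_bound Gamma beta pq n /\
    forall n', ell_bound Gamma beta pq n' -> (n <= n')%N]
    (ell Gamma beta pq) by [].
by apply: xgetPex; exists n; split=> // n' bn'; apply/min_n/asboolP.
Qed.

End Bound.

(** * The terms of the extremality equation *)

Section Terms.
Variables (R : realType) (k : nat) (d : 'I_k -> nat).
Variable Gamma : forall j, tensor R (slots d (groups k :\ j)).
Variable beta : tensor R (slots d (groups k)).
Implicit Types (s t pq : slot d) (x : slot d -> R).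

Local Notation m := (\sum_j d j)%N.
Local Notation hatG := (hatG Gamma).
Local Notation prodG := (prodG Gamma).
Local Notation regular := (regular Gamma beta).

(** The derivative of <mu,beta> by x_s, as the slope of an affine function; for s = pq this is
    b1. *)
Definition muslope s x : R := mu (upd x s 1) beta - mu (upd x s 0) beta.

Lemma muslope_upd s x y : muslope s (upd x s y) = muslope s x.
Proof. by rewrite /muslope !upd_upd. Qed.

Lemma mu_affine s x y :
  mu (upd x s y) beta = mu (upd x s 0) beta + y * muslope s x.
Proof. exact: pairing_dfw_affine. Qed.

Lemma uni_muX s x :
  uni s x (muX beta) = (mu (upd x s 0) beta)%:P + 'X * (muslope s x)%:P.
Proof.
rewrite uni_pairing pairing_dfw_affine.
have E z : pairing polyC (dfw (fun t => (x t)%:P) s z%:P) beta =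
    (mu (upd x s z) beta)%:P.
  rewrite /mu rmorph_pairing; apply: eq_pairing => // t _ /=.
  by rewrite updE dfwE; case: eqP.
by rewrite (E 0) (E 1) -polyCB.
Qed.

Lemma ev_partial_muX s x : ev x (partialX s (muX beta)) = muslope s x.
Proof.
rewrite -[x in LHS](dfw_id x s) -horner_uni -deriv_uni uni_muX.
by rewrite derivD derivM derivX !derivC mulr0 addr0 add0r mul1r hornerC.
Qed.

Lemma partial2_muX s : partialX s (partialX s (muX beta)) = 0.
Proof.
apply: (@mpoly_eq0_box _ _ _ (fun=> setT)) => [_|_|x _]; first exact: openT.
  by exists 0.
rewrite -(dfw_id x s) -horner_uni -!deriv_uni uni_muX.
by rewrite derivD derivM derivX !derivC mulr0 addr0 add0r mul1r derivC hornerC.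
Qed.

Lemma quot_iter1_const s n c (B : polyring R d) :
  quot_iter s B n 1 (mpoly.mpolyC _ c) = - (mpoly.mpolyC _ c * partialX s B *+ n).
Proof.
rewrite /= /quot_step [partialX s (mpoly.mpolyC _ c)]mpoly.mderivC.
by rewrite mul0r sub0r addn0.
Qed.

(** The numerator of the second derivative of c / B^n when B is affine in x_s. *)
Lemma quot_iter2_const s n c (B : polyring R d) :
  partialX s (partialX s B) = 0 ->
  quot_iter s B n 2 (mpoly.mpolyC _ c) =
  mpoly.mpolyC _ c * partialX s B ^+ 2 *+ (n * n.+1).
Proof.
move=> B2.
rewrite -[LHS]/(quot_step s B (n + 1) (quot_iter s B n 1 (mpoly.mpolyC _ c))).
rewrite quot_iter1_const /quot_step.
have -> : partialX s (- (mpoly.mpolyC _ c * partialX s B *+ n)) = 0.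
  rewrite {1}/partialX mpoly.mderivN mpoly.mderivMn mpoly.mderiv_mulC.
  by rewrite -[mpoly.mderiv _ _]/(partialX s (partialX s B)) B2 mulr0 mul0rn oppr0.
by rewrite mul0r sub0r mulNr mulNrn opprK mulrnAl -mulrnA addn1 -mulrA.
Qed.

Lemma lhsE_slots (A : slot d -> R -> R) x :
  lhsE Gamma beta A x = \sum_s prefactor Gamma beta s x *
    partial 2 s (fun z => A s (z s) / mu z beta ^+ (m + 1) * prodG z) x.
Proof.
by rewrite /lhsE sig_big_dep; apply: eq_bigr => -[i r] _.
Qed.

(** The Leibniz rule rewrites a term of the equation through the coefficients whose degrees define
    [ell]. *)
Lemma term_coefE (I : set R) (f : R -> R) pq s x : open I -> I (x s) ->
  (forall n y, I y -> derivable (derive1n n f) y 1) ->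
  (forall y, I y -> regular (upd x s y)) ->
  Delta x pq * prodG x * (prefactor Gamma beta s x *
    partial 2 s (fun z => f (z s) / mu z beta ^+ (m + 1) * prodG z) x) =
  \sum_(t < 3) Defs.coefE Gamma beta pq s t x * derive1n t f (x s).
Proof.
move=> oI Ix df reg; rewrite /partial.
pose g y := prodG (upd x s y) / mu (upd x s y) beta ^+ (m + 1).
have -> : (fun y => f (upd x s y s) / mu (upd x s y) beta ^+ (m + 1) *
    prodG (upd x s y)) = (fun y => f y * g y).
  by apply/funext => y; rewrite updE eqxx /g -mulrA [_^-1 * _]mulrC.
rewrite (@derive1n2_mul _ I)//; first last.
- move=> n y _ Iy; have [_ _ B0] := reg y Iy.
  have -> : g = (fun z => ev (dfw x s z) (prodGX Gamma) /
      ev (dfw x s z) (muX beta) ^+ (m + 1)).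
    apply/funext => z; rewrite ev_muX; congr (_ / _).
    rewrite rmorph_prod; apply: eq_bigr => b _; rewrite rmorphXn /=.
    by rewrite ev_pairing.
  by apply: (proj1 (derive1n_quot _ _ _ _)); rewrite ev_muX.
- by move=> n y _; exact: df.
rewrite !mulr_sumr; apply: eq_bigr => t _; rewrite /Defs.coefE /partial -/g.
ring.
Qed.

(** Along the x_pq-line the function to be differentiated is [N] times a constant over B^(m+1),
    because [E] is absorbed into [N]. The Leibniz rule with B affine gives the three summands. *)
Lemma term_pq (I : set R) (A N E : R -> R) c pq x : open I -> I (x pq) ->
  (forall n y, (n < 2)%N -> I y -> derivable (derive1n n N) y 1) ->
  (forall y, I y -> regular (upd x pq y)) ->
  (forall y, prodG (upd x pq y) = hatG x (tag pq) * c * E y) ->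
  (forall y, A y * E y = N y) ->
  Delta x pq * prodG x * (prefactor Gamma beta pq x *
    partial 2 pq (fun z => A (z pq) / mu z beta ^+ (m + 1) * prodG z) x) =
  c * (mu x beta ^+ 2 * derive1n 2 N (x pq)
       - (2 * (m + 1))%:R * mu x beta * muslope pq x * derive1n 1 N (x pq)
       + ((m + 1) * (m + 1).+1)%:R * muslope pq x ^+ 2 * N (x pq)).
Proof.
move=> oI Ix dN reg prodGE NE; rewrite /partial.
set n := (m + 1)%N.
pose P := mpoly.mpolyC #|{: slot d}| (hatG x (tag pq) * c).
pose g y := ev (dfw x pq y) P / ev (dfw x pq y) (muX beta) ^+ n.
have -> : (fun y => A (upd x pq y pq) / mu (upd x pq y) beta ^+ n *
    prodG (upd x pq y)) = (fun y => N y * g y).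
  apply/funext => y; rewrite updE eqxx /g -NE prodGE ev_C ev_muX.
  rewrite -[dfw _ _ _]/(upd x pq y); ring.
have dg j y : I y -> derivable (derive1n j g) y 1 /\
   derive1n j g y = ev (dfw x pq y) (quot_iter pq (muX beta) n j P)
     / ev (dfw x pq y) (muX beta) ^+ (n + j).
  by move=> Iy; apply: derive1n_quot; rewrite ev_muX; case: (reg y Iy).
rewrite (@derive1n2_mul _ I)//; last by move=> j y _ Iy; case: (dg j y Iy).
have := reg _ Ix; rewrite upd_id => rx.
have [/(_ pq) D0 /(_ (tag pq)) H0 B0] := rx.
have G0 := prodG_neq0 rx.
have E2 : derive1 (derive1 g) (x pq) = _ := proj2 (dg 2%N _ Ix).
have E1 : derive1 g (x pq) = _ := proj2 (dg 1%N _ Ix).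
rewrite !big_ord_recl big_ord0 /= E2 E1 -[bump 0 0]/1%N -[bump 0 1]/2%N /g.
rewrite quot_iter1_const (quot_iter2_const _ _ (partial2_muX pq)).
rewrite dfw_id rmorphN !rmorphMn !rmorphM /= !ev_C ev_muX ev_partial_muX.
rewrite /prefactor (_ : m + 3 = n + 2)%N; last by rewrite /n; lia.
rewrite !exprD expr1 -[(_ * muslope pq x) *+ n]mulr_natr.
rewrite -[_ *+ (n * n.+1)]mulr_natr.
rewrite !natrM bin0 bin1 binn.
field; by rewrite G0 D0 H0 B0 expf_neq0.
Qed.

End Terms.

(** * Functions that agree with a polynomial of bounded degree *)

Definition polynomial_on (R : realType) (l : nat) (I : set R) (f : R -> R) :=
  exists2 P : {poly R}, (size P <= l.+1)%N & forall y, I y -> f y = P.[y].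

Section PolynomialOn.
Variables (R : realType) (l : nat) (I : set R).
Implicit Types f g : R -> R.

Lemma polynomial_onZD a f g : polynomial_on l I f -> polynomial_on l I g ->
  polynomial_on l I (fun y => a * f y + g y).
Proof.
move=> [P sP fP] [Q sQ gQ]; exists (a *: P + Q) => [|y Iy].
  rewrite (leq_trans (size_polyD _ _))// geq_max sQ andbT.
  exact: leq_trans (size_scale_leq _ _) sP.
by rewrite hornerD hornerZ fP// gQ.
Qed.

Lemma eq_polynomial_on f g : (forall y, I y -> f y = g y) ->
  polynomial_on l I g -> polynomial_on l I f.
Proof. by move=> fg [P sP gP]; exists P => // y Iy; rewrite fg// gP. Qed.

Lemma polynomial_on_sum (J : finType) (Q : pred J) (a : J -> R)
    (F : J -> R -> R) :
  (forall j, Q j -> polynomial_on l I (F j)) ->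
  polynomial_on l I (fun y => \sum_(j | Q j) a j * F j y).
Proof.
move=> FP; have [P hP] : exists P : J -> {poly R}, forall j, Q j ->
    (size (P j) <= l.+1)%N /\ forall y, I y -> F j y = (P j).[y].
  suff H j : exists P : {poly R}, Q j ->
      (size P <= l.+1)%N /\ forall y, I y -> F j y = P.[y].
    exists (fun j => projT1 (cid (H j))) => j Qj.
    by case: cid => P /= hP; exact: hP.
  have [Qj|_] := boolP (Q j); last by exists 0.
  by have [P sP fP] := FP j Qj; exists P.
exists (\sum_(j | Q j) a j *: P j) => [|y Iy].
  elim/big_ind: _ => [|p q sp sq|j /hP[sP _]]; first by rewrite size_poly0.
    by rewrite (leq_trans (size_polyD _ _))// geq_max sp.
  exact: leq_trans (size_scale_leq _ _) sP.
rewrite horner_sum; apply: eq_bigr => j /hP[_ fP].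
by rewrite hornerZ fP.
Qed.

End PolynomialOn.

(** * The pq-term for a solution of the extremality equation *)

Section Extremality.
Variables (R : realType) (k : nat) (d : 'I_k -> nat).
Variable Gamma : forall j, tensor R (slots d (groups k :\ j)).
Variable beta : tensor R (slots d (groups k)).
Variables (I : slot d -> set R) (A : slot d -> R -> R).
Hypothesis hsol : extremal_solution Gamma beta I A.
Implicit Types (s t pq : slot d) (x : slot d -> R).

Local Notation m := (\sum_j d j)%N.
Local Notation hatG := (hatG Gamma).
Local Notation prodG := (prodG Gamma).
Local Notation regular := (regular Gamma beta).
Local Notation box x := (forall s, I s (x s)).

Lemma box_upd x s y : box x -> I s y -> box (upd x s y).
Proof. by move=> bx Iy t; rewrite updE; case: eqP => [->|]. Qed.

Lemma xdeg_le_box pq n f x : box x -> xdeg_le Gamma beta pq n f ->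
  polynomial_on n (I pq) (fun y => f (upd x pq y)).
Proof.
have [_ _ reg _] := hsol; move=> bx /xdeg_leP[F [Finv Fs fF]].
exists (F x) => // y Iy; rewrite fF; last exact/reg/box_upd.
by rewrite Finv updE eqxx.
Qed.

(** Solve the multiplied equation for its pq-term. With the other variables frozen, the functions
    [A s], s != pq, and their derivatives are constants, and [ell] bounds the degrees of their
    coefficients and of the right-hand side. *)
Lemma term_pq_polynomial pq x (N E : R -> R) c : box x -> c != 0 ->
  (forall n y, (n < 2)%N -> I pq y -> derivable (derive1n n N) y 1) ->
  (forall y, prodG (upd x pq y) = hatG x (tag pq) * c * E y) ->
  (forall y, A pq y * E y = N y) ->
  polynomial_on (ell Gamma beta pq) (I pq) (fun y =>
    mu (upd x pq y) beta ^+ 2 * derive1n 2 N y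
    - (2 * (m + 1))%:R * mu (upd x pq y) beta * muslope beta pq x
      * derive1n 1 N y
    + ((m + 1) * (m + 1).+1)%:R * muslope beta pq x ^+ 2 * N y).
Proof.
move=> bx c0 dN prodGE NE; have [oI sA reg [alpha ha eqE]] := hsol.
have [bcoef brhs] := ell_boundP Gamma beta pq.
pose T s y := \sum_(t < 3)
  derive1n t (A s) (x s) * Defs.coefE Gamma beta pq s t (upd x pq y).
apply: (@eq_polynomial_on _ _ _ _ (fun y =>
    c^-1 * rhsE Gamma pq alpha (upd x pq y)
    + \sum_(s | s != pq) - c^-1 * T s y)); last first.
  apply: polynomial_onZD; first exact/xdeg_le_box/brhs.
  apply: polynomial_on_sum => s spq; apply: polynomial_on_sum => t _.
  exact/xdeg_le_box/bcoef.
move=> y Iy; apply: (mulfI c0).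
have by' := box_upd bx Iy; set x' := upd x pq y in by' *.
have x's s : s != pq -> x' s = x s by move=> spq; rewrite /x' updE ifN.
have x'pq : x' pq = y by rewrite /x' updE eqxx.
have [oIpq _ _] := oI pq.
have Ex' z : prodG (upd x' pq z) = hatG x' (tag pq) * c * E z.
  by rewrite /x' upd_upd prodGE hatG_upd.
have regx' s z : I s z -> regular (upd x' s z) by move=> Iz; apply/reg/box_upd.
have := term_pq oIpq (by' pq) dN (regx' pq) Ex' NE.
rewrite x'pq {1}/x' muslope_upd => <-.
rewrite mulrDr mulVKf// mulr_sumr.
rewrite /rhsE -(eqE _ by') lhsE_slots (bigD1 pq)//= mulrDr mulr_sumr.
rewrite -addrA -big_split /=.
rewrite [X in _ = _ + X]big1 ?addr0// => s spq; have [oIs _ _] := oI s.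
rewrite (term_coefE pq oIs (by' s) _ (regx' s)); last first.
  by move=> n z Iz; case: (sA s z Iz).
rewrite mulNr mulrN mulVKf// /T -sumrB big1// => t _.
by rewrite x's// mulrC subrr.
Qed.

End Extremality.

(** * Independence of the quadratic forms in B and its derivative *)

Section Independence.
Variables (R : realType) (k : nat) (d : 'I_k -> nat).
Variable beta : tensor R (slots d (groups k)).
Implicit Types (s pq : slot d) (x : slot d -> R).

Lemma subst_varC s c : subst_var s c%:P = mpoly.mpolyC _ c :> polyring R d.
Proof. by rewrite /subst_var map_polyC hornerC. Qed.

Lemma ev_subst_var s x (u : {poly R}) : ev x (subst_var s u) = u.[x s].
Proof.
rewrite /subst_var -horner_map /= ev_X -map_poly_comp /=.
by rewrite map_poly_id// => c _; exact: ev_C.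
Qed.

(** Transfers independence over R(x_pq) from the forms in B and B' to real relations on the box
    between the forms in b0 and b1. *)
Lemma muX_forms_independent pq (I : slot d -> set R) (c0 c1 c2 : R) :
  (forall s, open (I s)) -> (forall s, I s !=set0) ->
  lin_indep_over pq (fun t : 'I_3 => FracField.tofrac
    (tnth [tuple muX beta ^+ 2; muX beta * partialX pq (muX beta);
           partialX pq (muX beta) ^+ 2] t)) ->
  (forall x, (forall s, I s (x s)) ->
     c0 * mu (upd x pq 0) beta ^+ 2
     + c1 * (mu (upd x pq 0) beta * muslope beta pq x)
     + c2 * muslope beta pq x ^+ 2 = 0) ->
  [/\ c0 = 0, c1 = 0 & c2 = 0].
Proof.
set B := muX beta; set B' := partialX pq B => oI nI indep c_eq0.
(* Coefficients of B^2, B B', B'^2 after the substitution b0 = B - x_pq B', b1 = B'. They are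
   triangular in [c0], [c1], [c2]. *)
pose u : 'I_3 -> {poly R} := tnth [tuple c0%:P; c1%:P - (2 * c0)%:P * 'X;
  c0%:P * 'X ^+ 2 - c1%:P * 'X + c2%:P].
have P0 : \sum_t subst_var pq (u t) * tnth [tuple B ^+ 2; B * B'; B' ^+ 2] t = 0.
  apply: (mpoly_eq0_box oI nI) => x Ix.
  rewrite !big_ord_recl big_ord0 /u !(tnth_nth 0) /= addr0 !rmorphD !rmorphM /=.
  rewrite !ev_subst_var ev_muX ev_partial_muX -[in mu _ _](upd_id x pq).
  rewrite mu_affine !(hornerD, hornerN, hornerM, hornerXn, hornerX, hornerC).
  by rewrite -[RHS](c_eq0 x Ix); ring.
have u0 (t : 'I_3) : subst_var pq (u t) = 0.
  apply/eqP; rewrite -tofrac_eq0; apply/eqP; move: t.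
  apply: (indep (fun t => FracField.tofrac (subst_var pq (u t)))) => [t|].
    exists (u t), 1; rewrite oner_neq0; split=> //.
    by rewrite subst_varC mpoly.mpolyC1 tofrac1 divr1.
  rewrite -[RHS]tofrac0 -P0 rmorph_sum; apply: eq_bigr => t _.
  by rewrite -(rmorphM (@FracField.tofrac _)).
have K c : subst_var pq c%:P = 0 :> polyring R d -> c = 0.
  by rewrite subst_varC => c_0; rewrite -(@ev_C _ _ d (fun=> 0) c) c_0 rmorph0.
have c00 : c0 = 0 by apply: K; rewrite -(u0 ord0).
have c10 : c1 = 0.
  apply: K; rewrite -(u0 (lift ord0 ord0)) /u (tnth_nth 0) /= c00.
  by rewrite mulr0 mul0r subr0.
have c20 : c2 = 0.
  apply: K; rewrite -(u0 ord_max) /u (tnth_nth 0) /= c00 c10.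
  by rewrite !mul0r subr0 add0r.
by split.
Qed.

End Independence.

(** * The degree bound for the numerator of A_pq *)

Theorem corollary3p2p3 (R : realType) (k : nat) (d : 'I_k -> nat)
    (Gamma : forall j : 'I_k, tensor R (slots d (groups k :\ j)))
    (beta : tensor R (slots d (groups k)))
    (p : 'I_k) (q : 'I_(d p))
    (e : 'I_k -> 'rV[R]_2)
    (tGamma : forall j : 'I_k, tensor R (slots d ((groups k :\ j) :\ p)))
    (hSV : segre_veronese Gamma)
    (hbeta : beta \in frakh Gamma) (hbeta0 : beta != 0)
    (hdec : forall j : 'I_k, j != p ->
       Gamma j = ins (tGamma j) (tpow (d p) (e j)))
    (hell : (ell Gamma beta (mkslot q) < \sum_j d j)%N)
    (hindep : let B := muX beta in
       let B' := partialX (mkslot q) B in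
       lin_indep_over (mkslot q)
         (fun t : 'I_3 => FracField.tofrac
            (tnth [tuple B ^+ 2; B * B'; B' ^+ 2] t)))
    (I : slot d -> set R) (A : slot d -> R -> R)
    (hsol : extremal_solution Gamma beta I A) :
  exists N : {poly R},
    (forall x : R, I (mkslot q) x ->
       A (mkslot q) x
       = N.[x] / \prod_(j < k | j != p) dot (pt x) (e j) ^+ d j) /\
    (size N <= (ell Gamma beta (mkslot q)).+1)%N.
Proof.
have [oI sA reg _] := hsol; set pq := mkslot q in hell hindep *.
have oI' s : open (I s) by case: (oI s).
have nI s : I s !=set0 by case: (oI s).
pose x0 s := xget 0 (I s).
have bx0 s : I s (x0 s) by have [y Iy] := nI s; apply: xgetPex; exists y.
pose E : {poly R} := \prod_(j < k | j != p) ((e j 0 0)%:P + (e j 0 1) *: 'X) ^+ d j.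
have EE y : E.[y] = \prod_(j < k | j != p) dot (pt y) (e j) ^+ d j.
  rewrite horner_prod; apply: eq_bigr => j _; rewrite horner_exp; congr (_ ^+ _).
  rewrite hornerD hornerC hornerZ hornerX /dot big_ord_recl big_ord1 !mxE /=.
  by rewrite expr0 expr1 mul1r mulrC (_ : lift _ _ = 1)//; apply/val_inj.
(* Each Gamma_j with j != p contributes its linear factor to the power d_j. Since d_p >= 1, one
   factor hatG_p can be split off, and its other powers go into [c]. *)
have prodGE x : exists c, forall y,
    prodG Gamma (upd x pq y) = hatG Gamma x p * c * E.[y].
  have /choice[h hE] j : exists h, j != p -> forall y,
      hatG Gamma (upd x pq y) j = dot (pt y) (e j) * h.
    have [->|jp] := eqVneq j p; first by exists 0 => /eqP.
    have pG : p \in groups k :\ j by rewrite !inE andbT eq_sym.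
    have [h hE] := pairing_ins_tpow q (tGamma j) (e j) x pG.
    by exists h => _ y; rewrite -hE /hatG hdec.
  exists (hatG Gamma x p ^+ (d p).-1 * \prod_(j < k | j != p) h j ^+ d j) => y.
  rewrite /prodG (bigD1 p)//= (hatG_upd Gamma x pq y) mulrA -exprS prednK; last first.
    by case: (q) => r /= /(leq_ltn_trans (leq0n _)).
  rewrite EE -mulrA -big_split /=; congr (_ * _); apply: eq_bigr => j jp.
  by rewrite hE// exprMn mulrC.
pose N y := A pq y * E.[y].
have dN n y : (n < 2)%N -> I pq y -> derivable (derive1n n N) y 1.
  case: n => [|[|//]] _ Iy.
    apply: derivableM; last exact: derivable_horner.
    by have [_ /(_ 0%N)] := sA pq y Iy.
  apply: (@near_eq_derivable _ _ _ (derive1 (A pq) * horner E + A pq * horner E^`())).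
    near=> z; have Iz : I pq z by near: z; exact: open_nbhs_nbhs.
    have [_ /(_ 0%N) dz] := sA pq z Iz; rewrite [RHS]derive1E.
    rewrite (deriveM dz (@derivable_horner _ E z)) -!derive1E -derivE.
    by rewrite addrC /GRing.scale /= [E.[z] * _]mulrC.
  have [_ dA] := sA pq y Iy.
  apply: derivableD.
    exact: derivableM (dA 1%N) (@derivable_horner _ E y).
  exact: derivableM (dA 0%N) (@derivable_horner _ E^`() y).
(* [E] divides [prodG], which does not vanish on the box. *)
have E_neq0 y : I pq y -> E.[y] != 0.
  move=> Iy; have [c cE] := prodGE x0.
  have := prodG_neq0 (reg _ (box_upd bx0 Iy)).
  by rewrite cE mulf_eq0 => /norP[].
pose n := (\sum_j d j + 1)%N.
pose f0 y := derive1 (derive1 N) y.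
pose f1 y := 2 * y * f0 y - (2 * n)%:R * derive1 N y.
pose f2 y := y ^+ 2 * f0 y - (2 * n)%:R * y * derive1 N y + (n * n.+1)%:R * N y.
(* The combinations of the three functions that are polynomials of degree at most [ell] form a
   subspace of R^3. *)
pose W (v : 'rV[R]_3) := polynomial_on (ell Gamma beta pq) (I pq)
  (fun y => v 0 0 * f0 y + v 0 1 * f1 y + v 0 2 * f2 y).
(* Expanding B = b0 + y b1 in the pq-term shows that (b0^2, b0 b1, b1^2) lies in [W]. *)
have Wbox x : (forall s, I s (x s)) -> W (\row_i tnth [tuple
    mu (upd x pq 0) beta ^+ 2; mu (upd x pq 0) beta * muslope beta pq x;
    muslope beta pq x ^+ 2] i).
  move=> bx; have [c cE] := prodGE x.
  have c0 : c != 0.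
    have := prodG_neq0 (reg _ bx); rewrite -(upd_id x pq) cE.
    by rewrite !mulf_eq0 => /norP[/norP[]].
  have := term_pq_polynomial hsol bx c0 dN cE (fun=> erefl).
  apply: eq_polynomial_on => y Iy; rewrite !mxE !(tnth_nth 0) /=.
  rewrite (mu_affine _ _ _ y) /f2 /f1 /f0 /n.
  ring.
(* A column that annihilates [W] is a relation between the three forms on the whole box, hence
   zero. *)
have Wfull : forall v, W v.
  apply: subspace_full => [|a u v Wu Wv|c Wc].
  - exists 0 => [|y _]; first by rewrite size_poly0.
    by rewrite !mxE !mul0r !addr0 horner0.
  - apply: eq_polynomial_on (polynomial_onZD a Wu Wv) => y _.
    by rewrite !mxE; ring.
  - have [] := @muX_forms_independent _ _ _ beta pq I
      (c 0 0) (c 1 0) (c 2 0) oI' nI hindep.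
      move=> x /Wbox/Wc/matrixP/(_ 0 0).
      rewrite !mxE !big_ord_recl big_ord0 !mxE !(tnth_nth 0) /= => h.
      rewrite -[RHS]h addr0 addrA ![c _ 0 * _]mulrC.
      by congr (_ * c _ _ + _ * c _ _ + _ * c _ _); exact: val_inj.
    move=> c0 c1 c2; apply/colP => i; rewrite mxE.
    by case: i => [[|[|[|//]]] i3]; [rewrite -c0|rewrite -c1|rewrite -c2];
      congr (c _ _); exact: val_inj.
(* The unit vectors isolate [f0], [f1] and [f2]. *)
have [P0 sP0 P0E] := Wfull (delta_mx 0 0).
have [P1 sP1 P1E] := Wfull (delta_mx 0 1).
have [P2 sP2 P2E] := Wfull (delta_mx 0 2).
have ln : ((ell Gamma beta pq).+1 < n)%N by rewrite /n addn1 ltnS.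
have dN1 y : I pq y -> is_derive y 1 N (derive1 N y).
  by move=> Iy; rewrite derive1E; apply/derivableP/(dN 0%N).
have dN2 y : I pq y -> is_derive y 1 (derive1 N) (f0 y).
  by move=> Iy; rewrite /f0 derive1E; apply/derivableP/(dN 1%N).
have [|||Q sQ NQ] :=
  polynomial_of_derivatives ln (oI' pq) (nI pq) dN1 dN2 sP0 sP1 sP2.
- by move=> y /P0E <-; rewrite !mxE /=; ring.
- by move=> y /P1E <-; rewrite !mxE /=; rewrite -/(f1 y); ring.
- by move=> y /P2E <-; rewrite !mxE /=; rewrite -/(f2 y); ring.
exists Q; split=> // y Iy.
by rewrite -NQ// -EE /N mulfK// E_neq0.
Unshelve. all: by end_near. Qed.
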